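(* Let $\mathbf{k}$ be a commutative unital ring, let $\kappa,\lambda\in\mathbf{k}$, let $(A,\mu)$ be a commutative algebra over $\mathbf{k}$ and $\mathcal{D}:A\to A$ a modified derivation of weight $\lambda$. Define $$a\rhd_{\mathcal{D}}b:=a\mathcal{D}(b)+\kappa ab\quad\text{for }a,b\in A.$$ Then $(A,\rhd_{\mathcal{D}})$ is a pre-Lie algebra and a Novikov algebra.
   Context: An algebra is an associative algebra, possibly without unit. A modified derivation of weight $\lambda$ of an algebra $A$ is a linear map $\mathcal{D}:A\to A$ with $\mathcal{D}(ab)=a\mathcal{D}(b)+\mathcal{D}(a)b+\lambda ab$ for all $a,b\in A$. A (left) pre-Lie algebra is a $\mathbf{k}$-module $A$ with a bilinear operation $\rhd$ satisfying $(a\rhd b)\rhd c-a\rhd(b\rhd c)=(b\rhd a)\rhd c-b\rhd(a\rhd c)$ for all $a,b,c\in A$. A Novikov algebra is a (left) pre-Lie algebra $(A,\rhd)$ satisfying in addition $(a\rhd b)\rhd c=(a\rhd c)\rhd b$ for all $a,b,c\in A$. *)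

(* Defs.v *)
From mathcomp Require Import all_boot all_algebra.

Set Implicit Arguments.
Unset Strict Implicit.
Unset Printing Implicit Defensive.

Import GRing.Theory.
Local Open Scope ring_scope.

(* Algebras here need not have a unit, so the ring-based algebra structures of *)
(* MathComp do not apply: an algebra is an lmodType with an explicit product.  *)

(* Same content as MathComp's bilinear_for *:%R *:%R, which is only available  *)
(* over an nzRingType; here the zero ring is allowed as a base ring.           *)
Definition bilinear_op (k : comPzRingType) (A : lmodType k)
    (op : A -> A -> A) : Prop :=
  (forall b : A, linear (op^~ b)) /\ (forall a : A, linear (op a)).

Record is_comm_algebra (k : comPzRingType) (A : lmodType k)
    (mu : A -> A -> A) : Prop := IsCommAlgebra {
  comm_algebra_bilinear : bilinear_op mu;
  comm_algebra_assoc : associative mu;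
  comm_algebra_comm : commutative mu
}.

Definition is_modified_derivation (k : comPzRingType) (A : lmodType k)
    (mu : A -> A -> A) (lambda : k) (D : A -> A) : Prop :=
  linear D /\
  forall a b : A, D (mu a b) = mu a (D b) + mu (D a) b + lambda *: mu a b.

Record is_pre_Lie (k : comPzRingType) (A : lmodType k)
    (op : A -> A -> A) : Prop := IsPreLie {
  pre_Lie_bilinear : bilinear_op op;
  pre_Lie_identity : forall a b c : A,
    op (op a b) c - op a (op b c) = op (op b a) c - op b (op a c)
}.

Record is_Novikov (k : comPzRingType) (A : lmodType k)
    (op : A -> A -> A) : Prop := IsNovikov {
  Novikov_pre_Lie : is_pre_Lie op;
  Novikov_right_comm : forall a b c : A, op (op a b) c = op (op a c) b
}.

Definition deriv_op (k : comPzRingType) (A : lmodType k)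
    (mu : A -> A -> A) (D : A -> A) (kappa : k) (a b : A) : A :=
  mu a (D b) + kappa *: mu a b.

(* Main.v *)
Require Import Defs.
From mathcomp Require Import all_boot all_algebra.

(** The shift [E := D + kappa id] of a modified derivation of weight [lambda]
    is a modified derivation, of weight [lambda - kappa], and
    [deriv_op mu D kappa a b = a E(b)].  So the scalar [kappa] can be absorbed
    into the derivation.  For a modified derivation [E] of weight [nu], the
    Leibniz rule expands [a E(b E(c))] into
    [a b E(E(c)) + a E(b) E(c) + nu a b E(c)], and the middle term is exactly
    the product of [a E(b)] with [E(c)].  What remains of the associator is
    [- a b (E(E(c)) + nu E(c))], which is symmetric in [a] and [b] because the
    algebra is commutative: this is the pre-Lie identity.  The Novikov identity
    only says that [a E(b) E(c)] is symmetric in [b] and [c]. *)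

Set Implicit Arguments.
Unset Strict Implicit.
Unset Printing Implicit Defensive.

Import GRing.Theory.
Local Open Scope ring_scope.

Lemma linear_add (k : comPzRingType) (U V : lmodType k) (f : U -> V) :
  linear f -> {morph f : x y / x + y}.
Proof. by case/GRing.semilinear_linear. Qed.

Section CommutativeAlgebra.

Variables (k : comPzRingType) (A : lmodType k) (mu : A -> A -> A).
Hypothesis hmu : is_comm_algebra mu.

Let muC := comm_algebra_comm hmu.
Let muA := comm_algebra_assoc hmu.
Let mu_linl := (comm_algebra_bilinear hmu).1.
Let mu_linr := (comm_algebra_bilinear hmu).2.

Lemma modified_derivation_shift (kappa lambda : k) (D : A -> A) :
  is_modified_derivation mu lambda D ->
  is_modified_derivation mu (lambda - kappa) (fun b => D b + kappa *: b).
Proof.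
case=> DL Dmu; split=> [s x y | a b].
  by rewrite DL !scalerDr !scalerA (mulrC s) addrACA.
rewrite Dmu (linear_add (mu_linr a)) (linear_add (mu_linl b)) /=.
rewrite (GRing.scalable_linear (mu_linr a)) (GRing.scalable_linear (mu_linl b)) /=.
(* Of the two terms [kappa a b] on the right, the weight cancels one. *)
rewrite scalerBl -!addrA; congr (_ + _).
by rewrite subrKC [RHS]addrCA [X in _ + X = _]addrC.
Qed.

Section DerivedProduct.

Variables (nu : k) (E : A -> A) (op : A -> A -> A).
Hypothesis hE : is_modified_derivation mu nu E.
Hypothesis opE : forall a b, op a b = mu a (E b).

Lemma bilinear_derived_product : bilinear_op op.
Proof.
split=> [b s x y | a s x y]; rewrite !opE; first exact: mu_linl.
by rewrite hE.1 mu_linr.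
Qed.

(** The quadratic terms [a E(b) E(c)] cancel, which leaves an expression
    depending on [a] and [b] only through their product. *)
Lemma derived_product_associator a b c :
  op (op a b) c - op a (op b c) = - mu (mu a b) (E (E c) + nu *: E c).
Proof.
rewrite !opE hE.2 !(linear_add (mu_linr _)).
rewrite !(GRing.scalable_linear (mu_linr _)) !muA.
by rewrite [in LHS]addrAC opprD [LHS]addrC subrK.
Qed.

Lemma derived_product_Novikov : is_Novikov op.
Proof.
split; last by move=> a b c; rewrite !opE -!muA (muC (E b)).
split; first exact: bilinear_derived_product.
by move=> a b c; rewrite !derived_product_associator (muC a).
Qed.

End DerivedProduct.

End CommutativeAlgebra.

Theorem theorem5p8 (k : comPzRingType) (kappa lambda : k) (A : lmodType k)
    (mu : A -> A -> A) (D : A -> A)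
    (hmu : is_comm_algebra mu) (hD : is_modified_derivation mu lambda D) :
  is_pre_Lie (deriv_op mu D kappa) /\ is_Novikov (deriv_op mu D kappa).
Proof.
have mu_linr := (comm_algebra_bilinear hmu).2.
have N : is_Novikov (deriv_op mu D kappa).
  apply: (derived_product_Novikov hmu
            (modified_derivation_shift hmu kappa hD)) => a b.
  by rewrite (linear_add (mu_linr a)) (GRing.scalable_linear (mu_linr a)).
by split; first exact: Novikov_pre_Lie N.
Qed.
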